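(* Let $d,r,n,t,k\ge 1$ be integers, let $F=(F_1,\dots,F_r)$ be an affine iterated function system on $\mathbb{R}^d$ satisfying (A1) and (A2) of the context, and let $\gamma>0$ be a margin as in (A3) of the context. Let $\mathcal{N}:\mathbb{R}^d\to\mathbb{R}$ be a ReLU neural network of depth $t$ and width $k$ such that $\operatorname{sign}(\mathcal{N}(x))=1$ for every $x\in K_n^\gamma$ and $\operatorname{sign}(\mathcal{N}(x))=-1$ for every $x\in\mathbb{R}^d\setminus K_n$. Denote by $s:=n/t$ the ratio between the depth of the fractal and the depth of the network. Then the width of the network grows exponentially with $s$, namely $$k\ \ge\ \frac{d}{e}\, r^{s/d}.$$
   Context: Affine IFS: maps $F_i(x)=M^{(i)}x+v^{(i)}$, $i=1,\dots,r$, with $M^{(i)}\in\mathbb{R}^{d\times d}$ of full rank, $v^{(i)}\in\mathbb{R}^d$, and $\|F_i(x)-F_i(y)\|<\|x-y\|$ for all $x\neq y$ ($\ell_2$ norm). Sets: $K_0=[-1,1]^d$ and $K_n=F_1(K_{n-1})\cup\dots\cup F_r(K_{n-1})$; $n$ is called the depth of the fractal $K_n$. For a set $A$, $A^\gamma=\{x\in A: B_\gamma(x)\subseteq A\}$, where $B_\gamma(x)$ is the ball of radius $\gamma$ around $x$. A fractal distribution of depth $n$ is a probability distribution $\mathcal{D}_n=\frac12(\mathcal{D}_n^++\mathcal{D}_n^-)$ on $\mathbb{R}^d\times\{\pm1\}$, where $\mathcal{D}_n^+$ is a probability distribution supported on $K_n\times\{+1\}$ and $\mathcal{D}_n^-$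 one supported on $(\mathbb{R}^d\setminus K_n)\times\{-1\}$. (A1) There is $\epsilon>0$ such that $d(F_i(K_0),F_j(K_0))>\epsilon$ for all $i\ne j\in\{1,\dots,r\}$, where $d(A,B)=\min_{x\in A,y\in B}\|x-y\|$. (A2) $F_i(K_0)\subseteq K_0$ for every $i\in\{1,\dots,r\}$. (A3) $\gamma>0$ is such that, for the fractal distribution $\mathcal{D}_n$ under consideration, $\mathcal{D}_n^+$ is supported on $K_n^\gamma\times\{+1\}$. A ReLU network of depth $t$ and width $k$ on $\mathbb{R}^d$: $x^{(0)}=x$, $x^{(t')}=\sigma(W^{(t')}x^{(t'-1)}+b^{(t')})$ for $1\le t'\le t-1$, and output $x^{(t)}=W^{(t)}x^{(t-1)}+b^{(t)}\in\mathbb{R}$, all hidden layers having dimension $k$, $\sigma(z)=\max(z,0)$ coordinatewise.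
   Formalization: Added hypothesis: the distribution D_n^+ of (A3) gives positive mass to each of the r^n pieces F_{w_1}(...F_{w_n}(K_0)) of K_n, so every piece meets K_n^γ; without it the claim is false. *)

(* Defs.v *)
(* R^d is represented by the column vectors 'cV[R]_d over R : realType. *)
From HB Require Import structures.
From mathcomp Require Import all_boot all_order all_algebra.
From mathcomp Require Import all_classical all_reals all_analysis.

Set Implicit Arguments.
Unset Strict Implicit.
Unset Printing Implicit Defensive.

Import Order.TTheory GRing.Theory Num.Theory.
Import numFieldNormedType.Exports.

Local Open Scope classical_set_scope.
Local Open Scope ring_scope.

(* The norm that the library puts on matrices is the sup norm, so the l2 norm
   is defined here. *)
Definition l2norm (R : realType) (d : nat) (x : 'cV[R]_d) : R :=
  Num.sqrt (\sum_(i < d) x i ord0 ^+ 2).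

Definition l2ball (R : realType) (d : nat) (x : 'cV[R]_d) (g : R) :
    set 'cV[R]_d :=
  [set y | l2norm (x - y) < g].

(* A minimum when A and B are nonempty and compact. *)
Definition l2dist (R : realType) (d : nat) (A B : set 'cV[R]_d) : R :=
  inf [set z | exists2 x, A x & exists2 y, B y & z = l2norm (x - y)].

Record affineIFS (R : realType) (d r : nat) : Type := AffineIFS {
  ifs_mx : 'I_r -> 'M[R]_d;
  ifs_vec : 'I_r -> 'cV[R]_d;
  ifs_full_rank : forall i, \rank (ifs_mx i) = d;
  ifs_contract : forall i (x y : 'cV[R]_d), x <> y ->
    l2norm ((ifs_mx i *m x + ifs_vec i) - (ifs_mx i *m y + ifs_vec i))
      < l2norm (x - y)
}.

Definition ifs_map (R : realType) (d r : nat) (F : affineIFS R d r) (i : 'I_r)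
    (x : 'cV[R]_d) : 'cV[R]_d :=
  ifs_mx F i *m x + ifs_vec F i.

Definition cube (R : realType) (d : nat) : set 'cV[R]_d :=
  [set x | forall i, -1 <= x i ord0 <= 1].

Fixpoint fractal (R : realType) (d r : nat) (F : affineIFS R d r) (n : nat) :
    set 'cV[R]_d :=
  match n with
  | 0%N => @cube R d
  | m.+1 => \bigcup_(i in [set: 'I_r]) (ifs_map F i @` fractal F m)
  end.

(* For w = (w_1, ..., w_n) this is F_(w_1)(...(F_(w_n)(K_0))); the union of
   these sets over all w of length n is the fractal K_n. *)
Definition ifs_piece (R : realType) (d r : nat) (F : affineIFS R d r)
    (w : seq 'I_r) : set 'cV[R]_d :=
  foldr (fun i A => ifs_map F i @` A) (@cube R d) w.

Definition ifs_separated (R : realType) (d r : nat) (F : affineIFS R d r) :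
    Prop :=
  exists2 eps : R, 0 < eps &
    forall i j : 'I_r, i != j ->
      eps < l2dist (ifs_map F i @` @cube R d) (ifs_map F j @` @cube R d).

Definition ifs_nested (R : realType) (d r : nat) (F : affineIFS R d r) : Prop :=
  forall i : 'I_r, ifs_map F i @` @cube R d `<=` @cube R d.

Definition margin_set (R : realType) (d : nat) (A : set 'cV[R]_d) (g : R) :
    set 'cV[R]_d :=
  [set x | A x /\ l2ball x g `<=` A].

(* R^d with its Borel sigma-algebra; the sup-norm topology of the library is
   the Euclidean one. *)
Notation borelRd R d := (g_sigma_algebraType (@open 'cV[R]_d)).

(* The labels +1 and -1 are encoded as true and false. *)
Notation labelled R d := (borelRd R d * bool)%type.

Definition supported_on (dsp : measure_display) (T : measurableType dsp)
    (R : realType) (P : probability T R) (S : set T) : Prop :=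
  P.-negligible (~` S).

Record fractal_distribution (R : realType) (d r : nat) (F : affineIFS R d r)
    (n : nat) : Type := FractalDistribution {
  fd_pos : probability (labelled R d) R;
  fd_neg : probability (labelled R d) R;
  fd_mix :> probability (labelled R d) R;
  fd_pos_supp : supported_on fd_pos (fractal F n `*` [set true]);
  fd_neg_supp : supported_on fd_neg ((~` fractal F n) `*` [set false]);
  fd_mixE : forall A : set (labelled R d), measurable A ->
    fd_mix A = ((2^-1)%:E * (fd_pos A + fd_neg A))%E
}.

Definition has_margin (R : realType) (d r : nat) (F : affineIFS R d r) (n : nat)
    (D : fractal_distribution F n) (g : R) : Prop :=
  supported_on (fd_pos D) (margin_set (fractal F n) g `*` [set true]).

(* [relu_net R k m t] is the type of networks with t affine layers, input
   dimension m, output dimension 1, and hidden layers of dimension k; the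
   argument m is an index because only the first layer sees the input
   dimension.  It is empty for t = 0. *)
Inductive relu_net (R : realType) (k : nat) : nat -> nat -> Type :=
| OutputLayer m (W : 'M[R]_(1, m)) (b : R) : relu_net R k m 1
| HiddenLayer m t (W : 'M[R]_(k, m)) (b : 'cV[R]_k) (N : relu_net R k k t) :
    relu_net R k m t.+1.

Definition relu (R : realType) (k : nat) (x : 'cV[R]_k) : 'cV[R]_k :=
  \col_i Num.max (x i ord0) 0.

Fixpoint net_eval (R : realType) (k m t : nat) (N : relu_net R k m t) :
    'cV[R]_m -> R :=
  match N in relu_net _ _ m t return 'cV[R]_m -> R with
  | OutputLayer _ W b => fun x => (W *m x) ord0 ord0 + b
  | HiddenLayer _ _ W b N' => fun x => net_eval N' (relu (W *m x + b))
  end.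

(* Main.v *)
(* Take one margin point of K_n in each of its r^n pieces.  A network that is
   affine along the segment between two of them is positive on the whole
   segment, which therefore stays inside K_n; by (A1) the two pieces are then
   the same.  So r^n is at most the number of linear regions of the network.
   Each hidden layer cuts a convex region of R^d, on which the previous layers
   are affine, into at most sum_{i <= d} C(k, i) regions, and this sum is at
   most (e k / d)^d when d <= k.  If k < d, or if there is no hidden layer, then
   the network is positive arbitrarily far away on a line through a margin
   point, contradicting that K_n is bounded. *)
Require Import Defs.
From mathcomp Require Import all_boot all_order all_algebra.
From mathcomp Require Import all_classical all_reals all_analysis.
From mathcomp Require Import ring lra.
Import Order.TTheory GRing.Theory Num.Theory.
Import numFieldNormedType.Exports.
Local Open Scope classical_set_scope.
Local Open Scope ring_scope.
Set Implicit Arguments.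
Unset Strict Implicit.
Unset Printing Implicit Defensive.

(** * Segments and binomial sums *)

Definition seg (R : realType) (V : lmodType R) (x y : V) (u : R) : V :=
  x + u *: (y - x).

Lemma segE (R : realType) (V : lmodType R) (x y : V) (u : R) :
  seg x y u = (1 - u) *: x + u *: y.
Proof. by rewrite /seg scalerBr scalerBl scale1r addrA addrAC. Qed.

Lemma affine_seg (R : realType) m d (A : 'M[R]_(m, d)) (c : 'cV[R]_m) x y u :
  A *m seg x y u + c = seg (A *m x + c) (A *m y + c) u.
Proof.
by rewrite /seg mulmxDr -scalemxAr mulmxBr [in RHS]opprD addrACA subrr addr0 addrAC.
Qed.

(** The maximal number of regions into which [k] hyperplanes cut a space of dimension [d]. *)
Definition cell_bound (d k : nat) : nat := \sum_(i < d.+1) 'C(k, i).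

Lemma cell_boundn0 d : cell_bound d 0 = 1%N.
Proof. by rewrite /cell_bound big_ord_recl bin0 big1. Qed.

Lemma cell_boundSS d k :
  cell_bound d.+1 k.+1 = (cell_bound d.+1 k + cell_bound d k)%N.
Proof.
rewrite /cell_bound big_ord_recl [X in (X + _)%N = _]bin0.
rewrite [in RHS]big_ord_recl [X in (X + _ + _)%N]bin0 -addnA; congr addn.
by rewrite -big_split; apply: eq_bigr => i _; rewrite binS.
Qed.

(** With [q = d/k <= 1], multiplying the sum by [q^d] gives at most the full sum of the
    [C(k,i) q^i], which is [(1+q)^k <= exp(qk) = e^d]. *)
Lemma cell_bound_le (R : realType) d k : (0 < d <= k)%N ->
  (cell_bound d k)%:R <= (expR 1 * k%:R / d%:R) ^+ d :> R.
Proof.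
move=> /andP[d0 dk]; have k0 := leq_trans d0 dk.
have d0R : (0 : R) < d%:R by rewrite ltr0n.
have k0R : (0 : R) < k%:R by rewrite ltr0n.
set q : R := d%:R / k%:R.
have q0 : 0 < q by rewrite divr_gt0.
have q1 : q <= 1 by rewrite ler_pdivrMr // mul1r ler_nat.
have -> : expR 1 * k%:R / d%:R = expR 1 / q :> R by rewrite /q invf_div mulrA.
rewrite expr_div_n ler_pdivlMr ?exprn_gt0 //.
have -> : expR 1 ^+ d = expR q ^+ k :> R.
  by rewrite -!expRM_natl mulr1 /q mulrCA divff ?mulr1 // gt_eqF.
apply: (@le_trans _ _ ((1 + q) ^+ k)); last first.
  by rewrite lerXn2r ?nnegrE ?expR_ge0 ?expR_ge1Dx // addr_ge0 // ltW.
rewrite exprDn natr_sum mulr_suml.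
rewrite (big_ord_widen k.+1 (fun i => 'C(k, i)%:R * q ^+ d)) ?ltnS //.
rewrite big_mkcond; apply: ler_sum => i _.
rewrite expr1n mul1r -[leRHS]mulr_natl; case: ifP => id.
  by rewrite ler_wpM2l // ler_wiXn2l // ltW.
by rewrite mulr_ge0 // exprn_ge0 // ltW.
Qed.

(** * Sign patterns of affine forms *)

Section Patterns.
Variable R : realType.

Definition affine_form d (f : 'rV[R]_d * R) (x : 'cV[R]_d) : R :=
  (f.1 *m x) ord0 ord0 + f.2.

(** Zero counts as negative, so every point has a pattern and the set of points with a given pattern
    is convex. *)
Definition sign_pattern d (fs : seq ('rV[R]_d * R)) (x : 'cV[R]_d) : seq bool :=
  [seq 0 < affine_form f x | f <- fs].

Lemma affine_form_seg d (f : 'rV[R]_d * R) x y u :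
  affine_form f (seg x y u) = (1 - u) * affine_form f x + u * affine_form f y.
Proof.
by rewrite /affine_form segE mulmxDr -!scalemxAr !mxE; ring.
Qed.

Lemma sign_pattern_seg d (fs : seq ('rV[R]_d * R)) x y u : 0 <= u <= 1 ->
  sign_pattern fs x = sign_pattern fs y ->
  sign_pattern fs (seg x y u) = sign_pattern fs x.
Proof.
move=> /andP[u0 u1]; elim: fs => //= f fs IH [fE /IH ->]; congr cons.
rewrite affine_form_seg; move: fE.
by case: (ltP 0 (affine_form f x)) => fx; case: (ltP 0 (affine_form f y)) => fy // _;
  [apply/idP|apply/negbTE; rewrite -leNgt]; nra.
Qed.

(** The equation is solved for a coordinate [j] with nonzero coefficient; the other [d] coordinates
    are the parameters. *)
Lemma hyperplane_param d (f : 'rV[R]_d.+1 * R) : f.1 != 0 ->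
  exists (B : 'M[R]_(d.+1, d)) (c : 'cV[R]_d.+1),
    forall z, affine_form f z = 0 -> exists y, z = B *m y + c.
Proof.
move=> /rV0Pn[j wj].
exists (\matrix_(i, l) if unlift j i is Some i' then (i' == l)%:R
                       else - (f.1 ord0 (lift j l) / f.1 ord0 j)).
exists (\col_i if i == j then - (f.2 / f.1 ord0 j) else 0).
move=> z; rewrite /affine_form mxE => fz; exists (row' j z).
apply/colP => i; rewrite !mxE.
case: (unliftP j i) => [i'|] ->.
  rewrite eq_sym (negbTE (neq_lift _ _)) addr0 (bigD1 i') //=.
  rewrite big1 => [|l /negbTE lj].
    by rewrite !mxE liftK eqxx mul1r addr0.
  by rewrite !mxE liftK eq_sym lj mul0r.
rewrite eqxx; under eq_bigr do rewrite !mxE unlift_none.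
rewrite (bigD1_ord j) //= in fz.
under eq_bigr do rewrite mulNr mulrAC.
rewrite sumrN -mulr_suml -opprD -mulrDl.
apply: (mulfI wj); rewrite mulrN mulrCA divff // mulr1.
by apply/eqP; rewrite -addr_eq0 addrA fz.
Qed.

(** Deletion and restriction: adding [f] creates a second pattern only from patterns of [fs] met on
    the hyperplane [f = 0], and Pascal's rule adds up the two counts. *)
Lemma sign_pattern_count d (fs : seq ('rV[R]_d * R)) :
  exists2 s : seq (seq bool), (size s <= cell_bound d (size fs))%N &
    forall x, sign_pattern fs x \in s.
Proof.
move En: (size fs) => n; elim: n d fs En => [|n IH] d [|f fs] //= => [_|[En]].
  by exists [:: [::]] => [|x]; rewrite ?cell_boundn0 // inE.
have [s sz_s sP] := IH d fs En.
(* The default sign of [f] on the region of [p]: positive as soon as it is positive somewhere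
   there. *)
pose sgn p := `[< exists2 x, sign_pattern fs x = p & 0 < affine_form f x >].
(* A constant form has one sign everywhere and adds no pattern. *)
have [f0|f0] := eqVneq f.1 0.
  exists [seq (0 < f.2) :: p | p <- s].
    rewrite size_map (leq_trans sz_s) //.
    by rewrite leq_sum // => i _ /=; rewrite leq_bin2l.
  by move=> x; rewrite /= {1}/affine_form f0 mul0mx mxE add0r map_f.
have d_gt0 : (0 < d)%N.
  rewrite lt0n; apply: contra_neq f0 => d0.
  by apply/rowP => i; have := leq_trans (ltn_ord i) (eq_leq d0).
case: d d_gt0 => // d _ in f fs En s sz_s sP sgn f0 *.
have [B [c BP]] := hyperplane_param f0.
have [|s2 sz2 s2P] := IH d [seq (g.1 *m B, affine_form g c) | g <- fs].
  by rewrite size_map.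
(* The second list collects the patterns of [fs] that occur on both sides of
   the hyperplane [f = 0]: each of them, its region being convex, also occurs
   on the hyperplane itself, which has dimension [d]. *)
exists ([seq sgn p :: p | p <- s] ++ [seq ~~ sgn p :: p | p <- s2]).
  by rewrite size_cat !size_map /= cell_boundSS leq_add.
move=> x; rewrite mem_cat; apply/orP.
have [fx|] := eqVneq (0 < affine_form f x) (sgn (sign_pattern fs x)).
  by left; rewrite /= fx (map_f (fun p => sgn p :: p)).
have [fx|fx] := ltP 0 (affine_form f x).
  move=> H; suff: sgn (sign_pattern fs x) by move=> E; rewrite E in H.
  by apply/asboolP; exists x.
rewrite eq_sym eqbF_neg negbK => sx; have /asboolP[y yp fy] := sx.
(* The zero of [f] on the segment from [x], where [f <= 0], to [y], where [f > 0]. *)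
right; pose u := affine_form f x / (affine_form f x - affine_form f y).
have [u01 fz] : 0 <= u <= 1 /\ affine_form f (seg x y u) = 0.
  have D0 : affine_form f x - affine_form f y < 0 by lra.
  split; last by rewrite affine_form_seg /u; field; rewrite lt_eqF.
  by rewrite /u ler_ndivlMr // ler_ndivrMr //; apply/andP; split; lra.
have zp := sign_pattern_seg u01 (esym yp).
have [v zE] := BP _ fz.
have -> : false = ~~ sgn (sign_pattern fs x) by rewrite sx.
apply: (map_f (fun p => ~~ sgn p :: p)).
rewrite -zp zE.
suff -> : sign_pattern fs (B *m v + c) =
    sign_pattern [seq (g.1 *m B, affine_form g c) | g <- fs] v.
  exact: s2P.
rewrite /sign_pattern -map_comp; apply: eq_map => g /=.
by rewrite /affine_form /= mulmxDr mulmxA mxE addrA.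
Qed.

End Patterns.

(** * Cells on which a network is affine *)

Section Cells.
Variable R : realType.

Lemma relu_net_depth_gt0 k m t : relu_net R k m t -> (0 < t)%N.
Proof. by case. Qed.

Definition row_forms k d (W : 'M[R]_(k, d)) (b : 'cV[R]_k) :
    seq ('rV[R]_d * R) :=
  [seq (row i W, b i ord0) | i <- enum 'I_k].

Lemma affine_form_row k d (W : 'M[R]_(k, d)) (b : 'cV[R]_k) i x :
  affine_form (row i W, b i ord0) x = (W *m x + b) i ord0.
Proof. by rewrite /affine_form -row_mul !mxE. Qed.

(** Keeps the active units, so [relu] is linear once the pattern is fixed; a pattern that is too
    short is padded with inactive units. *)
Definition mask_mx k (p : seq bool) : 'M[R]_k :=
  diag_mx (\row_(i < k) (nth false p i)%:R).

Lemma relu_mask k d (W : 'M[R]_(k, d)) (b : 'cV[R]_k) x :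
  relu (W *m x + b) = mask_mx k (sign_pattern (row_forms W b) x) *m (W *m x + b).
Proof.
apply/colP => i; rewrite mul_diag_mx !mxE /sign_pattern -map_comp.
rewrite (nth_map i) ?size_enum_ord // nth_ord_enum /= affine_form_row !mxE.
by case: ltP => _; rewrite ?mul1r ?mul0r.
Qed.

(** [l] numbers the cells. Composing with an affine map from dimension [d] makes the induction work:
    for a fixed pattern the layer's output is again affine in the original input, so every layer is
    counted in dimension [d], not [k]. *)
Lemma net_cells k m t (N : relu_net R k m t) d (A : 'M[R]_(m, d)) c :
  exists2 l : 'cV[R]_d -> nat, (forall x, (l x < cell_bound d k ^ t.-1)%N) &
    forall x y (u : R), l x = l y -> 0 <= u <= 1 ->
      net_eval N (A *m seg x y u + c) =
        (1 - u) * net_eval N (A *m x + c) + u * net_eval N (A *m y + c).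
Proof.
elim: N A c => {m t} [m W b|m t W b N IH] A c.
  exists (fun=> 0%N) => //= x y u _ _.
  by rewrite affine_seg; exact: (affine_form_seg (W, b)).
set fs := row_forms (W *m A) (W *m c + b).
have [s s_size sP] := sign_pattern_count fs.
rewrite size_map size_enum_ord in s_size.
have WE z : W *m (A *m z + c) + b = (W *m A) *m z + (W *m c + b).
  by rewrite mulmxDr mulmxA addrA.
pose A' p := mask_mx k p *m (W *m A); pose c' p := mask_mx k p *m (W *m c + b).
have reluE z : relu (W *m (A *m z + c) + b) =
    A' (sign_pattern fs z) *m z + c' (sign_pattern fs z).
  by rewrite WE relu_mask mulmxDr mulmxA.
have /choice[l lP] : forall p, exists l : 'cV[R]_d -> nat,
    (forall x, (l x < cell_bound d k ^ t.-1)%N) /\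
    forall x y (u : R), l x = l y -> 0 <= u <= 1 ->
      net_eval N (A' p *m seg x y u + c' p) =
      (1 - u) * net_eval N (A' p *m x + c' p) + u * net_eval N (A' p *m y + c' p).
  by move=> p; have [l l1 l2] := IH (A' p) (c' p); exists l.
set M := (cell_bound d k ^ t.-1)%N in lP.
have lM p x : (l p x < M)%N by have [] := lP p.
(* Base [M] encoding: the quotient by [M] recovers the pattern, the remainder the label in the rest
   of the network. *)
exists (fun x => index (sign_pattern fs x) s * M + l (sign_pattern fs x) x)%N.
  move=> x; rewrite -[X in (_ ^ X)%N]/t -(prednK (relu_net_depth_gt0 N)) expnS.
  have: (index (sign_pattern fs x) s < cell_bound d k)%N.
    by rewrite (leq_trans _ s_size) // index_mem.
  rewrite -(leq_pmul2r (leq_ltn_trans (leq0n _) (lM (sign_pattern fs x) x))).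
  by apply: leq_trans; rewrite mulSn addnC ltn_add2r.
move=> x y u lxy u01.
have M_gt0 : (0 < M)%N := leq_ltn_trans (leq0n _) (lM (sign_pattern fs x) x).
have pxy : sign_pattern fs x = sign_pattern fs y.
  have := congr1 (fun a => (a %/ M)%N) lxy.
  rewrite !divnMDl // !divn_small // !addn0 => ixy.
  by rewrite -(nth_index [::] (sP x)) ixy nth_index.
have {}lxy : l (sign_pattern fs x) x = l (sign_pattern fs x) y.
  by have := congr1 (fun a => (a %% M)%N) lxy; rewrite !modnMDl !modn_small // -pxy.
rewrite /= !reluE -pxy (sign_pattern_seg u01 pxy).
by have [_ ->] := lP (sign_pattern fs x).
Qed.
End Cells.

(** * Pieces of the fractal and their separation *)

Section Geometry.
Variables (R : realType) (d : nat).

Lemma l2normZ (a : R) (x : 'cV[R]_d) : l2norm (a *: x) = `|a| * l2norm x.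
Proof.
rewrite /l2norm -sqrtr_sqr -sqrtrM ?sqr_ge0 // mulr_sumr.
by congr Num.sqrt; apply: eq_bigr => i _; rewrite mxE exprMn.
Qed.

Lemma l2dist_le (A B : set 'cV[R]_d) x y : A x -> B y ->
  l2dist A B <= l2norm (x - y).
Proof.
move=> Ax By; apply: ge_inf; last by exists x => //; exists y.
by exists 0 => z [x' _ [y' _ ->]]; exact: sqrtr_ge0.
Qed.

Lemma cube_seg (x y : 'cV[R]_d) u : cube x -> cube y -> 0 <= u <= 1 ->
  cube (seg x y u).
Proof.
move=> xC yC /andP[u0 u1] i; rewrite segE !mxE.
have /andP[x1 x2] := xC i; have /andP[y1 y2] := yC i.
by apply/andP; split; nra.
Qed.

Variables (r : nat) (F : affineIFS R d r).

Lemma ifs_mx_unit i : ifs_mx F i \in unitmx.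
Proof. by rewrite -row_full_unit /row_full ifs_full_rank. Qed.

Lemma ifs_map_inj i : injective (ifs_map F i).
Proof.
move=> x y /addIr xy.
have F_unit := ifs_mx_unit i.
by rewrite -(mulKmx F_unit x) xy mulKmx.
Qed.

(** By full rank a piece is also a preimage of the cube, so that closedness, and then measurability,
    follow from continuity. *)
Lemma ifs_piece_affine (w : seq 'I_r) :
  exists (A : 'M[R]_d) c, ifs_piece F w = [set x | cube (A *m x + c)].
Proof.
elim: w => [|i w [A [c IH]]].
  by exists 1%:M, 0; apply/seteqP; split => x /=; rewrite mul1mx addr0.
have F_unit := ifs_mx_unit i.
exists (A *m invmx (ifs_mx F i)), (c - A *m invmx (ifs_mx F i) *m ifs_vec F i).
apply/seteqP; rewrite /= IH; split => [_ [x xC <-]|x xC] /=.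
  by rewrite /ifs_map mulmxDr -mulmxA mulKmx // addrACA subrr addr0.
exists (invmx (ifs_mx F i) *m (x - ifs_vec F i)).
  by rewrite /= mulmxA mulmxBr addrAC -addrA.
by rewrite /ifs_map mulKVmx // subrK.
Qed.

Lemma closed_cube_preimage (A : 'M[R]_d) c :
  closed [set x : 'cV[R]_d | cube (A *m x + c)].
Proof.
have -> : [set x : 'cV[R]_d | cube (A *m x + c)] =
    \bigcap_(i in [set: 'I_d])
      (fun x : 'cV[R]_d => (A *m x + c) i ord0) @^-1` `[-1, 1].
  apply/seteqP; split => x /= xC i; last by have /= := xC i I; rewrite in_itv.
  by move=> _ /=; rewrite in_itv /=; exact: xC.
apply: closed_bigI => i _; apply: preimage_closed; last exact: itv_closed.
suff cont : continuous (fun x : 'cV[R]_d => (A *m x + c) i ord0 : R).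
  by move=> x _; exact: cont.
have -> : (fun x : 'cV[R]_d => (A *m x + c) i ord0) =
    (fun x => \sum_j A i j * x j ord0 + c i ord0).
  by apply/funext => z; rewrite !mxE.
move=> x; apply: continuousD; last exact: cst_continuous.
apply: continuous_big => [|j _ y]; first exact: add_continuous.
apply: continuousM; first exact: cst_continuous.
exact: coord_continuous.
Qed.

Lemma ifs_piece_measurable (w : seq 'I_r) :
  measurable (ifs_piece F w : set (borelRd R d)).
Proof.
have [A [c ->]] := ifs_piece_affine w.
rewrite -[X in measurable X]setCK; apply: measurableC.
by apply: sub_sigma_algebra; apply: closed_openC; exact: closed_cube_preimage.
Qed.

Hypotheses (A1 : ifs_separated F) (A2 : ifs_nested F).

Lemma fractal_cube n : fractal F n `<=` cube (d:=d).
Proof.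
by elim: n => // n IH x [i _ [y /IH yC <-]]; apply: (A2 (i := i)); exists y.
Qed.

Lemma ifs_piece_cube w : ifs_piece F w `<=` cube (d:=d).
Proof.
by elim: w => // i w IH x [y /IH yC <-]; apply: (A2 (i := i)); exists y.
Qed.

Lemma ifs_images_disjoint i j z : (ifs_map F i @` @cube R d) z ->
  (ifs_map F j @` @cube R d) z -> i = j.
Proof.
have [e e0 sep] := A1; move=> zi zj; apply: contrapT => /eqP /sep.
apply/negP; rewrite -leNgt (le_trans (l2dist_le zi zj)) // subrr.
by rewrite -(scale0r 0) l2normZ normr0 mul0r ltW.
Qed.

(* Consecutive points of a fine enough subdivision of the segment are closer
   than the gap given by (A1), so they lie in the same first-level image. *)
Lemma seg_same_image i j (x y : 'cV[R]_d) :
  (ifs_map F i @` @cube R d) x -> (ifs_map F j @` @cube R d) y ->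
  (forall u : R, 0 <= u <= 1 ->
    exists l, (ifs_map F l @` @cube R d) (seg x y u)) -> i = j.
Proof.
move=> xi yj cover; have [e e0 sep] := A1.
(* Enough steps to make each of length at most [e]; the gap in (A1) is strictly larger. *)
pose m := (Num.truncn (l2norm (y - x) / e)).+1.
have m0 : (0 : R) < m%:R by rewrite ltr0n.
have step : l2norm (y - x) / m%:R <= e.
  by rewrite ler_pdivrMr // mulrC -ler_pdivrMr // ltW // truncnS_gt.
have chain p : (p <= m)%N -> (ifs_map F i @` @cube R d) (seg x y (p%:R / m%:R)).
  elim: p => [|p IH] pm; first by rewrite mul0r /seg scale0r addr0.
  have /cover[l lP] : 0 <= (p.+1%:R : R) / m%:R <= 1.
    by rewrite divr_ge0 //= ler_pdivrMr // mul1r ler_nat.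
  have [->//|/sep] := eqVneq i l.
  suff H : l2dist (ifs_map F i @` @cube R d) (ifs_map F l @` @cube R d) <= e.
    by rewrite ltNge H.
  apply: le_trans (l2dist_le (IH (ltnW pm)) lP) _.
  suff -> : seg x y (p%:R / m%:R) - seg x y (p.+1%:R / m%:R) =
      (- m%:R^-1) *: (y - x).
    by rewrite l2normZ normrN gtr0_norm ?invr_gt0 // mulrC.
  rewrite /seg opprD addrACA subrr add0r -scalerBl -mulrBl -natr1.
  by congr (_ *: _); rewrite opprD addrA subrr add0r mulN1r.
apply: ifs_images_disjoint yj; have := chain m (leqnn m).
by rewrite divff ?gt_eqF // /seg scale1r addrC subrK.
Qed.

(** Induction on the words: the first-level images cover the segment, so the first letters agree; by
    injectivity of that map the segment pulls back to one inside the fractal of depth [n - 1]. *)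
Lemma seg_fractal_same_piece n (w w' : seq 'I_r) x y :
  size w = n -> size w' = n -> ifs_piece F w x -> ifs_piece F w' y ->
  (forall u : R, 0 <= u <= 1 -> fractal F n (seg x y u)) -> w = w'.
Proof.
elim: n w w' x y => [|n IH] [|i w] [|j w'] x0 y0 //= [wn] [wn'].
move=> [x xw <-] [y yw <-] xy.
have im l p (z : 'cV[R]_d) : ifs_piece F p z ->
    (ifs_map F l @` @cube R d) (ifs_map F l z).
  by move/ifs_piece_cube => zC; exists z.
have ij : i = j.
  apply: (seg_same_image (im i _ _ xw) (im j _ _ yw)) => u /xy[l _ [z zn <-]].
  by exists l, z => //; exact: fractal_cube zn.
subst j; congr cons; apply: (IH _ _ x y wn wn' xw yw) => u u01.
have [l _ [z zn zE]] := xy u u01.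
move: zE; rewrite /ifs_map -affine_seg -/(ifs_map F l z) -/(ifs_map F i (seg x y u)).
move=> zE.
(* The cube is convex, so this point also lies in the [i]-th image, which is disjoint from the
   others. *)
have li : l = i.
  apply: (@ifs_images_disjoint _ _ (ifs_map F l z)).
    by exists z => //; exact: fractal_cube zn.
  rewrite zE; exists (seg x y u) => //.
  by apply: cube_seg => //; [exact: ifs_piece_cube xw|exact: ifs_piece_cube yw].
by rewrite li in zE; rewrite -(ifs_map_inj zE).
Qed.

End Geometry.

(** * Margin points, lines of positivity and the final count *)

(** A piece without margin points would lie in a null set of [fd_pos]. *)
Lemma margin_point (R : realType) (d r n : nat) (F : affineIFS R d r)
    (D : fractal_distribution F n) (g : R) (w : seq 'I_r) :
  has_margin D g -> (0 < fd_pos D (ifs_piece F w `*` [set true]))%E ->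
  exists2 x, ifs_piece F w x & margin_set (fractal F n) g x.
Proof.
move=> [A [mA A0 sub]] w_pos; apply: contrapT => nx.
move: w_pos; apply/negP; rewrite -leNgt -A0.
apply: le_measure; rewrite ?inE //.
  by apply: measurableX => //; exact: ifs_piece_measurable.
by move=> [x b] /= [xw ->]; apply: sub => -[xm _]; apply: nx; exists x.
Qed.

(** An affine function positive at [x0] cannot be nonpositive at two points symmetric about [x0]. If
    [k < m], the first layer has a kernel vector, along which the network is constant. *)
Lemma net_pos_line (R : realType) k m t (N : relu_net R k m t) x0 :
  (0 < m)%N -> (t == 1)%N || (k < m)%N -> 0 < net_eval N x0 ->
  exists2 v, v != 0 & forall a : R,
    0 < net_eval N (x0 + a *: v) \/ 0 < net_eval N (x0 - a *: v).
Proof.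
move=> m0; case: N x0 m0 => {m t} [m W b|m t W b N] x0 m0 tk N0.
  exists (const_mx 1).
    apply/eqP => /matrixP /(_ (Ordinal m0) ord0); rewrite !mxE.
    by apply/eqP; exact: oner_neq0.
  move=> a; move: N0; rewrite /= mulmxDr mulmxBr !mxE.
  set p := \sum_(_ < _) _; set q := \sum_(_ < _) _ => N0.
  by have [?|?] := ltP 0 (p + q + b); [left|right; lra].
have {}tk : (k < m)%N.
  case/orP: tk => // /eqP[t0].
  by have := relu_net_depth_gt0 N; rewrite t0.
have : kermx W^T != 0.
  rewrite kermx_eq0 /row_free mxrank_tr neq_ltn.
  by rewrite (leq_ltn_trans (rank_leq_row W) tk).
case/rowV0Pn => v /sub_kermxP vW v0; exists v^T; first by rewrite trmx_eq0.
move=> a; left; rewrite /= mulmxDr -scalemxAr.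
by rewrite -[W *m v^T]trmxK trmx_mul trmxK vW trmx0 scaler0 addr0.
Qed.

Theorem theorem2 (R : realType) (d r n t k : nat)
  (hd : (1 <= d)%N) (hr : (1 <= r)%N) (hn : (1 <= n)%N)
  (ht : (1 <= t)%N) (hk : (1 <= k)%N)
  (F : affineIFS R d r)
  (A1 : ifs_separated F) (A2 : ifs_nested F)
  (gamma : R) (hgamma : 0 < gamma)
  (D : fractal_distribution F n)
  (A3 : has_margin D gamma)
  (hD : forall w : n.-tuple 'I_r, (0 < fd_pos D (ifs_piece F w `*` [set true]))%E)
  (N : relu_net R k d t)
  (hpos : forall x, margin_set (fractal F n) gamma x -> Num.sg (net_eval N x) = 1)
  (hneg : forall x, ~ fractal F n x -> Num.sg (net_eval N x) = -1) :
  let s : R := n%:R / t%:R in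
  d%:R / expR 1 * r%:R `^ (s / d%:R) <= k%:R.
Proof.
cbv zeta.
have pos_fractal x : 0 < net_eval N x -> fractal F n x.
  move=> x0; apply: contrapT => /hneg; rewrite gtr0_sg // => /eqP.
  by rewrite -subr_eq0 opprK gt_eqF // ltr0n.
have /choice[pt ptP] : forall w : n.-tuple 'I_r, exists x,
    ifs_piece F w x /\ 0 < net_eval N x.
  move=> w; have [x xw xm] := margin_point A3 (hD w).
  by exists x; split => //; rewrite -sgr_gt0 hpos.
have [dk t_gt1] : (d <= k)%N /\ (1 < t)%N.
  have x0P := (ptP [tuple of nseq n (Ordinal hr)]).2.
  set x0 := pt _ in x0P.
  suff : ~~ ((t == 1)%N || (k < d)%N).
    by rewrite negb_or -leqNgt ltn_neqAle eq_sym ht andbT => /andP[].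
  apply/negP => tk.
  have [v /eqP/matrixP v0 vP] := net_pos_line hd tk x0P.
  have [i vi] : exists i, v i ord0 != 0.
    apply: contrapT => nv; apply: v0 => i j; rewrite ord1 mxE.
    by apply: contrapT => /eqP vi; apply: nv; exists i.
  have cube_i x : 0 < net_eval N x -> -1 <= x i ord0 <= 1.
    by move=> /pos_fractal /(fractal_cube A2); exact.
  have /andP[l1 l2] := cube_i _ x0P.
  (* A shift by 3 in coordinate [i] exceeds the side 2 of the cube, so it leaves the cube in either
     direction. *)
  by have [] := vP (3 / v i ord0) => /cube_i /andP[];
    rewrite !mxE divfK //; lra.
have [l lM lP] := net_cells N 1%:M (0 : 'cV_d).
(* Words to cells is injective: on a segment inside one cell the network is a convex combination of
   two positive values. *)
have rn : (r ^ n <= cell_bound d k ^ t.-1)%N.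
  rewrite -[X in (_ <= X)%N]card_ord -[r]card_ord -card_tuple.
  apply: (leq_card (fun w : n.-tuple 'I_r => Ordinal (lM (pt w)))).
  move=> w w' [lw]; apply: val_inj.
  have [ww Nw] := ptP w; have [ww' Nw'] := ptP w'.
  apply: (seg_fractal_same_piece A1 A2 (size_tuple w) (size_tuple w') ww ww').
  move=> u u01; apply: pos_fractal; have := lP _ _ u lw u01.
  rewrite !mul1mx !addr0 => ->; have /andP[u0 u1] := u01; nra.
have d0 : (0 : R) < d%:R by rewrite ltr0n.
have t0 : (0 : R) < t%:R by rewrite ltr0n.
have e0 : (0 : R) < expR 1 := expR_gt0 1.
have e1 : (1 : R) <= expR 1 by apply: le_trans (expR_ge1Dx 1); rewrite lerDl.
set b := expR 1 * k%:R / d%:R : R.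
(* This allows the exponent [t - 1] to be raised to [t] in [rb]. *)
have b1 : 1 <= b.
  by rewrite ler_pdivlMr // mul1r (le_trans (_ : _ <= k%:R)) ?ler_nat // ler_peMl.
have b0 : 0 <= b := le_trans ler01 b1.
have rb : (r%:R : R) ^+ n <= b ^+ (d * t).
  apply: (@le_trans _ _ ((cell_bound d k)%:R ^+ t.-1)); first by rewrite -!natrX ler_nat.
  apply: (@le_trans _ _ ((b ^+ d) ^+ t.-1)).
    by rewrite lerXn2r ?nnegrE ?exprn_ge0 // cell_bound_le // hd.
  by rewrite -exprM ler_weXn2l // leq_mul2l leq_pred orbT.
(* The goal becomes [r^(n/(dt)) <= b], the root of order [dt] of [rb]. *)
rewrite -ler_pdivlMl ?divr_gt0 // invf_div [leRHS]mulrAC -/b.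
have -> : n%:R / t%:R / d%:R = n%:R * (d * t)%:R^-1 :> R.
  by rewrite mulnC natrM invfM mulrA.
rewrite powRrM powR_mulrn //.
have dt_neq0 : (d * t)%:R != 0 :> R by rewrite natrM mulf_neq0 // gt_eqF.
apply: (@le_trans _ _ ((b ^+ (d * t)) `^ (d * t)%:R^-1)).
  by apply: ge0_ler_powR; rewrite ?nnegrE ?invr_ge0 ?exprn_ge0.
by rewrite -powR_mulrn // -powRrM divff // powRr1.
Qed.
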